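(* For every positive integer $m$ and every $0<\epsilon<1$ there exist $M = M(\epsilon,m)$ and $N=N(\epsilon,m)$ such that, if $n \geq N$, every permutation $\sigma : \mathbb{Z}_n\rightarrow\mathbb{Z}_n$ has an $(\epsilon,\mathcal{F})$-uniform partition $\{C_j\}_{j=0}^k$ for some $k$ with $m\leq k\leq M$, where $\mathcal{F}$ is a collection of $k$ nondecreasing $C^\infty$ functions $f_j:[0,1]\rightarrow[0,1]$, $1 \le j \le k$.
   Context: $\mathbb{Z}_n$ is identified with $\{0,1,\ldots,n-1\}$ with its usual linear order; an interval of $\mathbb{Z}_n$ is a set of consecutive integers in it. A partition $\{C_j\}_{j=0}^k$ of $\sigma$ means a partition of $\mathbb{Z}_n$ with a designated exceptional set $C_0$ (possibly empty, not necessarily an interval) and in which each $C_j$, $1\le j\le k$, is a nonempty interval. It is equitable if $|C_s|=|C_t|$ for all $1\le s,t\le k$. For nonempty $S\subset \mathbb{Z}_n$ and $\alpha\in[0,1]$, let $\mathcal{L}(S,\alpha) = |\sigma(S)\cap[0,\alpha n)|/|S|$. A function $f:[0,1]\to[0,1]$ is $\epsilon$-near $g:[0,1]\to[0,1]$ if for each $\alpha\in[0,1]$, $g(\alpha-\epsilon)-\epsilon\leq f(\alpha)\leq g(\alpha+\epsilon)+\epsilon$, with the convention $g(\alpha)=g(0)$ for $\alpha<0$ and $g(\alpha)=g(1)$ for $\alpha>1$. A partition $\{C_j\}_{j=0}^k$ of $\sigma$ is $(\epsilon,\mathcal{F})$-uniform, where $\mathcal{F}=\{f_s\}_{s=1}^k$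 is a family of functions $[0,1]\to[0,1]$, if it is equitable, $|C_0|\leq\epsilon n$, and for each $s\in\{1,\ldots,k\}$ and every interval $I\subset C_s$ with $|I|\geq\epsilon|C_s|$, the function $\mathcal{L}(I,\cdot)$ is $\epsilon$-near $f_s$. *)

(* Defs.v *)
From HB Require Import structures.
From mathcomp Require Import all_boot all_order all_algebra all_fingroup.
From mathcomp Require Import all_classical all_reals all_analysis.

Set Implicit Arguments.
Unset Strict Implicit.
Unset Printing Implicit Defensive.

Import Order.TTheory GRing.Theory Num.Theory.
Import numFieldNormedType.Exports.

Local Open Scope ring_scope.

(* Z_n is 'I_n with its usual linear order. *)

Definition is_interval_ord (n : nat) (S : {set 'I_n}) : Prop :=
  exists a b : nat, S = [set i : 'I_n | (a <= i < b)%N]%SET.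

(* The exceptional class C_0 is [C ord0]; for s : 'I_k, the class number s + 1
   is [C (lift ord0 s)].  MathComp's [partition] is not used because C_0 may
   be empty. *)
Definition interval_partition (n k : nat) (C : 'I_k.+1 -> {set 'I_n}) : Prop :=
  [/\ forall i j, i != j -> C i :&: C j = finset.set0,
      (\bigcup_(j < k.+1) C j)%SET = finset.setT &
      forall s : 'I_k, C (lift ord0 s) != finset.set0 /\
                       is_interval_ord (C (lift ord0 s))].

Definition equitable (n k : nat) (C : 'I_k.+1 -> {set 'I_n}) : Prop :=
  forall s t : 'I_k, #|C (lift ord0 s)| = #|C (lift ord0 t)|.

Definition image_density (R : realType) (n : nat) (sigma : {perm 'I_n})
    (S : {set 'I_n}) (alpha : R) : R :=
  #|[set x in (sigma @: S)%SET | (x : nat)%:R < alpha * n%:R]%SET|%:R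
    / #|S|%:R.

(* Functions on [0,1] are represented by functions R -> R whose values outside
   [0,1] are never used; [extend01 g] is the extension of g|[0,1] by the
   constants g 0 on the left and g 1 on the right. *)
Definition extend01 (R : realType) (g : R -> R) (x : R) : R :=
  if x < 0 then g 0 else if 1 < x then g 1 else g x.

Definition near_fun (R : realType) (eps : R) (f g : R -> R) : Prop :=
  forall alpha : R, 0 <= alpha <= 1 ->
    extend01 g (alpha - eps) - eps <= f alpha <=
    extend01 g (alpha + eps) + eps.

Definition uniform_partition (R : realType) (eps : R) (n : nat)
    (sigma : {perm 'I_n}) (k : nat) (F : 'I_k -> R -> R)
    (C : 'I_k.+1 -> {set 'I_n}) : Prop :=
  [/\ interval_partition C,
      equitable C,
      #|C ord0|%:R <= eps * n%:R &
      forall (s : 'I_k) (I : {set 'I_n}),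
        is_interval_ord I -> I \subset C (lift ord0 s) ->
        eps * #|C (lift ord0 s)|%:R <= #|I|%:R ->
        near_fun eps (image_density sigma I) (F s)].

(* At the endpoints this is the one-sided derivative. *)
Definition has_derivative01 (R : realType) (f : R -> R) (x l : R) : Prop :=
  ((f y - f x) / (y - x) @[y --> within `[0, 1] x^'] --> l)%classic.

(* C^oo on the closed interval [0,1]: D i is the i-th derivative of f. *)
Definition smooth01 (R : realType) (f : R -> R) : Prop :=
  exists D : nat -> R -> R,
    D 0%N = f /\
    forall (i : nat) (x : R), 0 <= x <= 1 ->
      has_derivative01 (D i) x (D i.+1 x).

Definition maps01 (R : realType) (f : R -> R) : Prop :=
  forall x : R, 0 <= x <= 1 -> 0 <= f x <= 1.

Definition nondecreasing01 (R : realType) (f : R -> R) : Prop :=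
  forall x y : R, 0 <= x -> x <= y -> y <= 1 -> f x <= f y.

(* Main.v *)
(** Fix finitely many levels [t / T] and, for each of them, record the
    indicator of [sigma i < (t / T) n].  Cut Z_n into 2m blocks, then refine
    repeatedly, splitting every block into q equal ones, J times.  The mean
    square of the block densities is at most the number of levels and grows
    under refinement, by at least d^2 / q times the proportion of blocks having
    a child whose density differs by more than d.  Hence at some scale all but a
    small proportion of the blocks have children with nearly the same densities as
    the block itself, and then so do all subintervals that are not too short.
    The bad blocks and the remainder of the division form C_0.  The density
    function of a good block, a sum of Heaviside steps, is smoothed by replacing
    each step by a steep logistic function. *)

Require Import Defs.
From HB Require Import structures.
From mathcomp Require Import all_boot all_order all_algebra all_fingroup.
From mathcomp Require Import all_classical all_reals all_analysis.
From mathcomp Require Import ring lra zify.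

Set Implicit Arguments.
Unset Strict Implicit.
Unset Printing Implicit Defensive.

Import Order.TTheory GRing.Theory Num.Theory.
Import numFieldNormedType.Exports.
Local Open Scope ring_scope.

(** * Derivatives on [0,1] and the logistic function *)

(** Restricting the filter to [0,1] keeps the limit, at the endpoints too, and [h = y - x] turns one
    difference quotient into the other. *)
Lemma is_derive_has_derivative01 (R : realType) (f : R -> R) (x l : R) :
  is_derive x 1 f l -> has_derivative01 f x l.
Proof.
move=> [df <-]; apply: cvg_trans (cvg_app _ (cvg_within _)) _.
have sh : (y - x @[y --> x^'] --> (0 : R)^')%classic.
  move=> A [e /= e0 eA]; exists e => //= y /= xy yx; apply: eA => /=.
    by rewrite sub0r normrN -normrN opprB.
  by rewrite subr_eq0.
have df' : (h^-1 *: ((f \o shift x) (h *: 1) - f x) @[h --> (0 : R)^']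
  --> 'D_1 f x)%classic by exact: df.
apply: cvg_trans (cvg_comp _ _ sh df').
apply: near_eq_cvg; near=> y.
by rewrite /= /GRing.scale/= mulr1 subrK mulrC.
Unshelve. all: by end_near. Qed.

Definition logistic (R : realType) (u : R) : R := (1 + expR (- u))^-1.

Lemma logistic_gt0 (R : realType) (u : R) : 0 < logistic u.
Proof. by rewrite invr_gt0 addr_gt0 ?expR_gt0. Qed.

Lemma logistic_lt1 (R : realType) (u : R) : logistic u < 1.
Proof. by rewrite invf_lt1 ?ltrDl ?addr_gt0 ?expR_gt0. Qed.

Lemma logistic_le (R : realType) (u v : R) : u <= v -> logistic u <= logistic v.
Proof.
by move=> uv; rewrite lef_pV2 ?posrE ?addr_gt0 ?expR_gt0// lerD2l ler_expR lerN2.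
Qed.

(** The crude bound [1 + x <= expR x] is enough, and it keeps logarithms out of the constants. *)
Lemma logistic_small (R : realType) (e u : R) : 0 < e -> u <= - e^-1 -> logistic u <= e.
Proof.
move=> e0 ue; rewrite -[leRHS]invrK lef_pV2 ?posrE ?invr_gt0 ?addr_gt0 ?expR_gt0//.
have := expR_ge1Dx (- u); lra.
Qed.

Lemma logisticN (R : realType) (u : R) : logistic (- u) = 1 - logistic u.
Proof.
rewrite /logistic opprK expRN.
have := expR_gt0 u; move: (expR u) => z z0; field.
by apply/andP; split; apply: lt0r_neq0; lra.
Qed.

Lemma logistic_large (R : realType) (e u : R) : 0 < e -> e^-1 <= u -> 1 - e <= logistic u.
Proof.
move=> e0 eu; have := @logistic_small _ e (- u) e0; rewrite logisticN lerN2 => /(_ eu); lra.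
Qed.

Lemma is_derive_logistic (R : realType) (u : R) :
  is_derive u 1 (@logistic R) (logistic u * (1 - logistic u)).
Proof.
have h : 1 + expR (- u) != 0 by rewrite lt0r_neq0// addr_gt0 ?expR_gt0.
have dN : is_derive u 1 (fun y : R => - y) (-1) by apply: is_derive_eq.
have dE := is_derive1_comp (is_derive_expR (- u)) dN.
have d1 : is_derive u 1 (fun y : R => 1 + expR (- y)) (0 + expR (- u) * -1).
  exact: is_deriveD.
apply: (is_derive_eq (@is_deriveV _ (fun y : R => 1 + expR (- y)) _ _ _ h d1)).
by rewrite /logistic /GRing.scale/=; field.
Qed.

Lemma is_derive_logistic_affine (R : realType) (P : {poly R}) (a b x : R) :
  is_derive x 1 (fun y => P.[logistic (a * y - b)])
    (a *: (('X - 'X ^+ 2) * P^`())).[logistic (a * x - b)].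
Proof.
have dA : is_derive x 1 (fun y : R => a * y - b) a.
  rewrite (_ : (fun _ => _) = horner (a%:P * 'X - b%:P)).
    apply: (is_derive_eq (is_derive_poly _ _)).
    by rewrite derivB derivC derivM derivC derivX !hornerE; ring.
  by apply/funext => y; rewrite !hornerE.
have dl := @is_derive1_comp _ (@logistic R) (fun y => a * y - b) _ _ _ (is_derive_logistic _) dA.
apply: (is_derive_eq (@is_derive1_comp _ (horner P) (fun y => logistic (a * y - b)) _ _ _ (is_derive_poly P _) dl)).
rewrite hornerZ hornerM hornerD hornerN hornerXn hornerX.
by rewrite expr2; ring.
Qed.

(* Every derivative of [logistic] is a polynomial in [logistic], because
   logistic' = logistic - logistic^2. *)
Lemma smooth01_logistic_sum (R : realType) (T : finType) (A : {set T}) (a w : R) (b : T -> R) :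
  smooth01 (fun x => (\sum_(i in A) logistic (a * x - b i)) * w).
Proof.
pose P i : {poly R} := iter i (fun Q => a *: (('X - 'X ^+ 2) * Q^`())) 'X.
exists (fun i x => (\sum_(j in A) (P i).[logistic (a * x - b j)]) * w); split.
  by apply: funext => x; under eq_bigr do rewrite hornerX.
move=> i x _; apply: is_derive_has_derivative01.
have dS : is_derive x 1 (fun y => \sum_(j in A) (P i).[logistic (a * y - b j)])
   (\sum_(j in A) (P i.+1).[logistic (a * x - b j)]).
  rewrite (_ : (fun _ => _) = \sum_(j in A) (fun y => (P i).[logistic (a * y - b j)])).
    elim/big_ind2 : _ => [|f df g dg|j _]; first exact: is_derive_cst.
      exact: is_deriveD.
    exact: is_derive_logistic_affine.
  by apply/funext => y; rewrite fct_sumE.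
apply: (is_derive_eq (is_deriveM dS (is_derive_cst w x 1))).
by rewrite /GRing.scale/=; ring.
Qed.

(** * Energy increment under refinement *)

Lemma sum_ord_mul (V : nmodType) (k q : nat) (F : nat -> V) :
  \sum_(i < k * q) F i = \sum_(i < k) \sum_(c < q) F (i * q + c)%N.
Proof.
elim: k => [|k ih]; first by rewrite mul0n !big_ord0.
by rewrite big_ord_recr/= -ih mulSn addnC big_split_ord.
Qed.

(** [a j i t] stands for the density at level [t] of block [i] at scale [j]; the children of this
    block are the blocks [i * q + c] at scale [j.+1]. *)
Definition good_block (R : realFieldType) (T q : nat) (a : nat -> nat -> 'I_T -> R)
    (d : R) (j i : nat) : bool :=
  [forall t, forall c : 'I_q, `|a j.+1 (i * q + c)%N t - a j i t| <= d].

Section energy.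
Variables (R : realFieldType) (T q J k0 : nat) (d e : R) (a : nat -> nat -> 'I_T -> R).
Hypotheses (q0 : (0 < q)%N) (k00 : (0 < k0)%N) (d0 : 0 < d).
Hypothesis a01 : forall j i t, 0 <= a j i t <= 1.
Hypothesis a_mean : forall j i t, (j < J)%N ->
  \sum_(c < q) a j.+1 (i * q + c)%N t = q%:R * a j i t.

Let E j := (\sum_(i < k0 * q ^ j) \sum_t (a j i t) ^+ 2) / (k0 * q ^ j)%:R.

Let size_gt0 j : 0 < (k0 * q ^ j)%:R :> R.
Proof. by rewrite ltr0n muln_gt0 k00 expn_gt0 q0. Qed.

Let E_le j : E j <= T%:R.
Proof.
rewrite /E ler_pdivrMr//.
apply: (@le_trans _ _ (\sum_(i < k0 * q ^ j) T%:R)); last first.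
  by rewrite sumr_const card_ord mulr_natr.
apply: ler_sum => i _; apply: (@le_trans _ _ (\sum_(t < T) 1)); last first.
  by rewrite sumr_const card_ord.
by apply: ler_sum => t _; have /andP[? ?] := a01 j i t; rewrite expr_le1.
Qed.

Let E_ge0 j : 0 <= E j.
Proof.
apply: divr_ge0; last exact: ltW.
by apply: sumr_ge0 => i _; apply: sumr_ge0 => t _; exact: sqr_ge0.
Qed.

(** By [a_mean] a block is the mean of its children, so its gain is their sum of squared deviations.
    In a bad block one deviation alone exceeds [d]. Averaging over [q] times as many blocks costs
    the factor [q]. *)
Let E_step j : (j < J)%N ->
  e * (k0 * q ^ j)%:R < #|[set i : 'I_(k0 * q ^ j) | ~~ good_block q a d j i]%SET|%:R ->
  E j + e * d ^+ 2 / q%:R <= E j.+1.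
Proof.
move=> jJ bad; have qR : 0 < q%:R :> R by rewrite ltr0n.
have sz := size_gt0 j.
rewrite /E expnSr mulnA (natrM _ (k0 * q ^ j)).
rewrite (sum_ord_mul _ _ (fun i => \sum_t a j.+1 i t ^+ 2)) ler_pdivlMr ?mulr_gt0// mulrDl.
set S := \sum_(i < _) _; set k := (k0 * q ^ j)%:R in sz bad *; clearbody k.
rewrite (_ : S / k * _ = q%:R * S); last by field; exact: lt0r_neq0.
rewrite (_ : _ / _ * _ = d ^+ 2 * (e * k)); last by field; exact: lt0r_neq0.
rewrite /S mulr_sumr -lerBrDl -sumrB.
set B := [set i : 'I_(k0 * q ^ j) | _]%SET in bad.
apply: (@le_trans _ _ (\sum_(i in B) d ^+ 2)).
  by rewrite sumr_const -[leRHS]mulr_natr ler_pM2l ?exprn_gt0// ltW.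
rewrite [leRHS](bigID (mem B))/=.
have var (i : 'I_(k0 * q ^ j)) :
    \sum_(c < q) \sum_t a j.+1 (i * q + c)%N t ^+ 2 - q%:R * (\sum_t a j i t ^+ 2) =
    \sum_t \sum_(c < q) (a j.+1 (i * q + c)%N t - a j i t) ^+ 2.
  rewrite exchange_big/= mulr_sumr -sumrB; apply: eq_bigr => t _.
  under [RHS]eq_bigr do rewrite sqrrB.
  rewrite !big_split/= sumr_const card_ord sumrN sumrMnl -mulr_suml a_mean//.
  rewrite -[_ *+ q]mulr_natl; ring.
rewrite -[leLHS]addr0; apply: lerD; last first.
  apply: sumr_ge0 => i _; rewrite var.
  by apply: sumr_ge0 => t _; apply: sumr_ge0 => c _; exact: sqr_ge0.
apply: ler_sum => i; rewrite inE /good_block negb_forall => /existsP[t].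
rewrite negb_forall => /existsP[c]; rewrite -ltNge => dc.
rewrite var (bigD1 t)//= (bigD1 c)//= -addrA -[leLHS]addr0 lerD//.
  by rewrite -[leRHS]real_normK ?num_real// lerXn2r// ?nnegrE ltW// d0.
rewrite addr_ge0 ?sumr_ge0// => *; rewrite ?sqr_ge0//.
by apply: sumr_ge0 => *; exact: sqr_ge0.
Qed.

(** Otherwise each of the [J] refinements would gain [e * d ^+ 2 / q], pushing the energy above its
    bound [T]. *)
Lemma energy_pigeonhole : T%:R * q%:R < J%:R * (e * d ^+ 2) ->
  exists2 j, (j < J)%N &
    #|[set i : 'I_(k0 * q ^ j) | ~~ good_block q a d j i]%SET|%:R <= e * (k0 * q ^ j)%:R.
Proof.
move=> big; have qR : 0 < q%:R :> R by rewrite ltr0n.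
apply: contrapT => nex.
have EJ j : (j <= J)%N -> j%:R * (e * d ^+ 2 / q%:R) <= E j.
  elim: j => [|j ih] jJ; first by rewrite mul0r.
  have := ih (ltnW jJ); have : E j + e * d ^+ 2 / q%:R <= E j.+1.
    by apply: E_step => //; rewrite ltNge; apply/negP => h; apply: nex; exists j.
  rewrite -natr1 mulrDl mul1r; lra.
have := le_trans (EJ J (leqnn J)) (E_le J).
by rewrite mulrA ler_pdivrMr// leNgt big.
Qed.

End energy.

(** * Image densities and their smoothing *)

(** Injectivity of [sigma] moves the count from the image to [S]; the sum of indicators can then be
    compared term by term with a sum of logistics. *)
Lemma image_densityE (R : realType) (n : nat) (sigma : {perm 'I_n})
    (S : {set 'I_n}) (alpha : R) :
  image_density sigma S alpha =
  (\sum_(o in S) ((sigma o : nat)%:R < alpha * n%:R)%R%:R) / #|S|%:R.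
Proof.
rewrite /image_density; congr (_ / _).
rewrite (_ : [set _ in _ | _]%SET =
    (sigma @: [set o in S | (sigma o : nat)%:R < alpha * n%:R]%SET)%SET).
  rewrite card_imset; last exact: perm_inj.
  rewrite -sum1_card natr_sum big_mkcond [RHS]big_mkcond/=; apply: eq_bigr => o _.
  by rewrite inE; case: (o \in S) => //=; case: (_ < _).
apply/setP => x; rewrite inE; apply/andP/imsetP => [[+ h] | [y]]; first case/imsetP=> o oS ex.
  by exists o => //; rewrite inE oS -ex.
by rewrite inE => /andP[yS h] ->; rewrite imset_f.
Qed.

Lemma image_density_le (R : realType) (n : nat) (sigma : {perm 'I_n})
    (S : {set 'I_n}) (a b : R) : a <= b ->
  image_density sigma S a <= image_density sigma S b.
Proof.
move=> ab; rewrite !image_densityE ler_wpM2r ?invr_ge0// ler_sum// => o _.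
rewrite ler_nat; case: ltP => //= h; rewrite (lt_le_trans h)//.
by rewrite ler_wpM2r.
Qed.

Lemma image_density_ge0 (R : realType) (n : nat) (sigma : {perm 'I_n})
    (S : {set 'I_n}) (a : R) : 0 <= image_density sigma S a.
Proof. exact: divr_ge0. Qed.

Lemma image_density_le1 (R : realType) (n : nat) (sigma : {perm 'I_n})
    (S : {set 'I_n}) (a : R) : image_density sigma S a <= 1.
Proof.
(* For empty [S] the quotient is 0 / 0, which is 0. *)
rewrite image_densityE; have [->|S0] := eqVneq S finset.set0.
  by rewrite big_set0 mul0r.
rewrite ler_pdivrMr ?ltr0n ?card_gt0// mul1r -sum1_card natr_sum ler_sum// => o _.
by rewrite ler_nat leq_b1.
Qed.

(* At [x] the steps are evaluated at [(1 + 4e) x - 2e], which overshoots [0,1] by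
   [2e] on both sides: this makes the value at most [e] at 0 and at least [1 - e] at 1,
   as the constant extension of the limit function outside [0,1] requires. *)
Definition smooth_density (R : realType) (n : nat) (sigma : {perm 'I_n})
    (S : {set 'I_n}) (e x : R) : R :=
  (\sum_(o in S) logistic ((1 + 4 * e) / e ^+ 2 * x
     - (2 * e + (sigma o : nat)%:R / n%:R) / e ^+ 2)) / #|S|%:R.

Section smooth_density.
Variables (R : realType) (n : nat) (sigma : {perm 'I_n}) (S : {set 'I_n}) (e : R).
Hypotheses (e0 : 0 < e) (S0 : S != finset.set0).
Let F := smooth_density sigma S e.

Let card_S : 0 < #|S|%:R :> R. Proof. by rewrite ltr0n card_gt0. Qed.

(** The stretched point [(1 + 4 * e) * x - 2 * e] appears as [x] plus a shift. Division by [e] twice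
    turns a distance of [e] from the step into [e^-1], the threshold of [logistic_small] and
    [logistic_large]. *)
Let argE (o : 'I_n) x : (1 + 4 * e) / e ^+ 2 * x
     - (2 * e + (sigma o : nat)%:R / n%:R) / e ^+ 2
   = (x + e * (4 * x - 2) - (sigma o : nat)%:R / n%:R) / e / e.
Proof.
have n0 : (0 < n)%N := leq_ltn_trans (leq0n o) (ltn_ord o).
by field; rewrite lt0r_neq0//= pnatr_eq0 -lt0n.
Qed.

Let arg_small (o : 'I_n) (x y : R) : x + e * (4 * x - 2) + e <= y ->
  y * n%:R <= (sigma o : nat)%:R ->
  logistic ((1 + 4 * e) / e ^+ 2 * x
     - (2 * e + (sigma o : nat)%:R / n%:R) / e ^+ 2) <= e.
Proof.
move=> xy yo; rewrite argE; apply: logistic_small => //.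
rewrite ler_pdivrMr// mulNr mulVf ?lt0r_neq0// ler_pdivrMr// mulN1r.
have n0 : 0 < n%:R :> R by rewrite ltr0n (leq_ltn_trans (leq0n o) (ltn_ord o)).
by move: yo; rewrite -ler_pdivlMr//; (move: e0; lra).
Qed.

Let arg_large (o : 'I_n) (x y : R) : y <= x + e * (4 * x - 2) - e ->
  (sigma o : nat)%:R < y * n%:R ->
  1 - e <= logistic ((1 + 4 * e) / e ^+ 2 * x
     - (2 * e + (sigma o : nat)%:R / n%:R) / e ^+ 2).
Proof.
move=> xy yo; rewrite argE; apply: logistic_large => //.
rewrite ler_pdivlMr// mulVf ?lt0r_neq0// ler_pdivlMr// mul1r.
have n0 : 0 < n%:R :> R by rewrite ltr0n (leq_ltn_trans (leq0n o) (ltn_ord o)).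
by move: yo; rewrite -ltr_pdivrMr//; (move: e0; lra).
Qed.

Lemma smooth_density_le x y : x <= y -> F x <= F y.
Proof.
move=> xy; rewrite /F /smooth_density ler_wpM2r ?invr_ge0// ler_sum// => o _.
apply: logistic_le; rewrite lerD2r ler_wpM2l// divr_ge0 ?exprn_ge0 ?(ltW e0)//; move: e0; lra.
Qed.

(** Term by term: if the indicator at [y] is 1, the logistic is below it; if it is 0, the step is
    far enough to the right for the logistic to be at most [e]. *)
Let F_le (x y : R) : x + e * (4 * x - 2) + e <= y -> F x <= image_density sigma S y + e.
Proof.
move=> xy; rewrite image_densityE /F /smooth_density.
rewrite ler_pdivrMr// [leRHS]mulrDl divfK ?lt0r_neq0//.
rewrite -sum1_card natr_sum mulr_sumr -big_split/= ler_sum// => o _.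
case: ltP => /= yo; first by have := logistic_lt1 ((1 + 4 * e) / e ^+ 2 * x
     - (2 * e + (sigma o : nat)%:R / n%:R) / e ^+ 2); (move: e0; lra).
by have := arg_small xy yo; (move: e0; lra).
Qed.

Let F_ge (x y : R) : y <= x + e * (4 * x - 2) - e -> image_density sigma S y - e <= F x.
Proof.
move=> xy; rewrite image_densityE /F /smooth_density.
rewrite ler_pdivlMr// [leLHS]mulrBl divfK ?lt0r_neq0//.
rewrite -sum1_card natr_sum mulr_sumr -sumrB ler_sum// => o _.
case: ltP => /= yo; last by have := logistic_gt0 ((1 + 4 * e) / e ^+ 2 * x
     - (2 * e + (sigma o : nat)%:R / n%:R) / e ^+ 2); (move: e0; lra).
by have := arg_large xy yo; (move: e0; lra).
Qed.

Lemma smooth_density01 : maps01 F.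
Proof.
move=> x _; apply/andP; split.
  by apply: divr_ge0 => //; apply: sumr_ge0 => *; exact/ltW/logistic_gt0.
rewrite /F /smooth_density ler_pdivrMr// mul1r -sum1_card natr_sum ler_sum// => *.
exact/ltW/logistic_lt1.
Qed.

Lemma smooth_density0 : F 0 <= e.
Proof.
(* The point 0 is stretched to [- 2 * e], and no value of [sigma] lies below [- e * n]. *)
have := @F_le 0 (- e); rewrite mulr0 => /(_ _)/le_trans; apply; first (move: e0; lra).
rewrite image_densityE big1 ?mul0r ?add0r// => o _.
case: ltP => //= h; suff : (sigma o : nat)%:R < 0 :> R by rewrite ltrn0.
by apply: lt_le_trans h _; rewrite mulNr oppr_le0 mulr_ge0// ltW.
Qed.

Lemma smooth_density1 : 1 - e <= F 1.
Proof.
apply: le_trans (@F_ge 1 1 _); last by (move: e0; lra).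
rewrite lerD2r image_densityE ler_pdivlMr// [leLHS]mul1r -sum1_card natr_sum ler_sum// => o _.
by rewrite mul1r ltr_nat ltn_ord.
Qed.

(** Stretching moves [x] to the right by at most [2 * e], and [F_le] asks for a margin of one more
    [e]. The lower bound is symmetric. *)
Lemma smooth_density_ub x : x <= 1 -> F x <= image_density sigma S (x + 3 * e) + e.
Proof. by move=> x1; apply: F_le; (move: e0; nra). Qed.

Lemma smooth_density_lb x : 0 <= x -> image_density sigma S (x - 3 * e) - e <= F x.
Proof. by move=> x0; apply: F_ge; (move: e0; nra). Qed.

(* The extra level (T + 1) / T lies strictly above alpha even when alpha = 1. *)
Lemma near_smooth_density (I : {set 'I_n}) (T : nat) : 1 <= e * T%:R ->
  (forall t : 'I_T.+2, `|image_density sigma I (t%:R / T%:R)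
     - image_density sigma S (t%:R / T%:R)| <= e) ->
  (* qualified, because MathComp-Analysis shadows [near_fun] *)
  Defs.near_fun (4 * e) (image_density sigma I) F.
Proof.
move=> eT close a /andP[a0 a1].
have T0 : 0 < T%:R :> R by rewrite -(pmulr_rgt0 _ e0); (move: e0; lra).
(* [a] lies between the levels [t / T] and [t.+1 / T]. Passing to a level shifts the argument by at
   most [e], smoothing by [3 * e]; replacing [I] by [S] and smoothing cost [e] each in value. *)
set t := Num.truncn (a * T%:R).
have /andP[ta at1] : t%:R <= a * T%:R < t.+1%:R.
  by rewrite /t truncn_itv// mulr_ge0// ltW.
have tT : (t <= T)%N.
  by rewrite -(ler_nat R); apply: le_trans ta _; rewrite ler_piMl// ltW.
have T1e : T%:R^-1 <= e by rewrite -[_^-1]mul1r ler_pdivrMr.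
have lo : a - e <= t%:R / T%:R.
  suff : a <= t.+1%:R / T%:R by rewrite -natr1 mulrDl mul1r; (move: e0; lra).
  by rewrite ler_pdivlMr// ltW.
have lo' : t%:R / T%:R <= a by rewrite ler_pdivrMr.
have hi : a <= t.+1%:R / T%:R by rewrite ler_pdivlMr// ltW.
have hi' : t.+1%:R / T%:R <= a + e by rewrite -natr1 mulrDl mul1r; (move: e0; lra).
have := close (Ordinal (leq_trans tT (leqnSn T) : (t < T.+2)%N)).
have := close (Ordinal (tT : (t.+1 < T.+2)%N)).
rewrite /= !ler_distlC => /andP[h1 h2] /andP[h3 h4].
have := image_density_le sigma I lo'; have := image_density_le sigma I hi.
have := image_density_le sigma S lo; have := image_density_le sigma S hi'.
have := smooth_density0; have := smooth_density1.
have := image_density_ge0 sigma I a; have := image_density_le1 sigma I a.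
move=> I1 I0 F1 F0 Shi Slo Ihi Ilo.
apply/andP; split; rewrite /extend01.
  (* Left of 0 the extension has the value [F 0 <= e], so nonnegativity of the density suffices. *)
  case: ltP => a4; first by (move: e0; lra).
  rewrite ltNge (_ : a - 4 * e <= 1) ?/=; last by (move: e0; lra).
  have := @smooth_density_ub (a - 4 * e).
  rewrite (_ : a - 4 * e + 3 * e = a - e); last ring.
  by move=> /(_ ltac:(move: e0; lra)); (move: e0; lra).
rewrite ltNge (_ : 0 <= a + 4 * e) ?/=; last by (move: e0; lra).
case: ltP => a4; first by (move: e0; lra).
have := @smooth_density_lb (a + 4 * e).
rewrite (_ : a + 4 * e - 3 * e = a + e); last ring.
by move=> /(_ ltac:(move: e0; lra)); (move: e0; lra).
Qed.

End smooth_density.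

(** * Means over blocks and subintervals through prefix sums *)

(** With [P] a prefix sum, this is the average over the block numbered [i] among those of length
    [l]. *)
Definition block_mean (R : fieldType) (P : nat -> R) (l i : nat) : R :=
  (P (i.+1 * l)%N - P (i * l)%N) / l%:R.

Lemma block_mean_sum (R : numFieldType) (P : nat -> R) (q l i : nat) :
  (0 < q)%N -> (0 < l)%N ->
  \sum_(c < q) block_mean P l (i * q + c) = q%:R * block_mean P (q * l) i.
Proof.
move=> q0 l0; rewrite /block_mean -mulr_suml -(big_mkord predT (fun c =>
  P ((i * q + c).+1 * l)%N - P ((i * q + c) * l)%N)).
under eq_bigr do rewrite -addnS.
rewrite (telescope_sumr (fun c => P ((i * q + c) * l)%N))// addn0 !mulnA mulSn (addnC q) natrM.
by field; rewrite !pnatr_eq0 -!lt0n q0 l0.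
Qed.

Section prefix.
Variables (R : realFieldType) (P : nat -> R).
Hypothesis P_incr : forall i, 0 <= P i.+1 - P i <= 1.

Lemma prefix_incr i k : 0 <= P (i + k)%N - P i <= k%:R.
Proof.
elim: k => [|k /andP[h1 h2]]; first by rewrite addn0 subrr lexx.
by have /andP[] := P_incr (i + k); rewrite addnS -natr1; lra.
Qed.

Lemma block_mean01 l i : (0 < l)%N -> 0 <= block_mean P l i <= 1.
Proof.
move=> l0; have := prefix_incr (i * l) l; rewrite -mulSnr => /andP[h1 h2].
by rewrite divr_ge0//= ler_pdivrMr ?ltr0n// mul1r.
Qed.

(** Each whole child contributes at most [l * d]. In the last, partial child both the increment of
    [P] and its prediction lie between 0 and [l], so they differ by at most [l]. *)
Lemma prefix_drift (q l x y : nat) (d A : R) : (0 < l)%N -> 0 <= A <= 1 -> 0 <= d ->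
  (forall c, (c < q)%N -> `|(P (x + c.+1 * l)%N - P (x + c * l)%N) / l%:R - A| <= d) ->
  (y <= q * l)%N -> `|P (x + y)%N - P x - y%:R * A| <= (q * l)%:R * d + l%:R.
Proof.
move=> l0 /andP[A0 A1] d0 close yql; have lR : 0 < l%:R :> R by rewrite ltr0n.
have drift c : (c <= q)%N -> `|P (x + c * l)%N - P x - (c * l)%:R * A| <= (c * l)%:R * d.
  elim: c => [|c ih] cq; first by rewrite mul0n addn0 mul0r subrr subr0 normr0 mul0r.
  have := ih (ltnW cq); have := close c cq.
  rewrite -(ler_pM2r lR) -{2}[l%:R]gtr0_norm// -normrM mulrBl divfK ?lt0r_neq0//.
  by rewrite [(c.+1 * l)%N]mulSn natrD !ler_norml !mulrDl => /andP[? ?] /andP[? ?]; apply/andP; split; lra.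
have cq : (y %/ l <= q)%N by rewrite -(mulnK q l0) leq_div2r.
have := drift _ cq; have := prefix_incr (x + y %/ l * l) (y %% l).
rewrite -addnA -divn_eq => /andP[r1 r2].
have rl : (y %% l)%:R <= l%:R :> R by rewrite ler_nat ltnW// ltn_mod.
have rA : (y %% l)%:R * A <= (y %% l)%:R by rewrite ler_piMr.
have rA0 : 0 <= (y %% l)%:R * A by rewrite mulr_ge0.
have cd : (y %/ l * l)%:R * d <= (q * l)%:R * d by rewrite ler_wpM2r// ler_nat leq_mul2r cq orbT.
have -> : y%:R = (y %/ l * l)%:R + (y %% l)%:R :> R by rewrite -natrD -divn_eq.
by rewrite !ler_norml mulrDl => /andP[? ?]; apply/andP; split; lra.
Qed.

(** Subtracting the drifts at [u] and [v] leaves an error of at most [2 * (q * l) * (d + q^-1)],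
    which is divided by a length of at least [e * (q * l)]. *)
Lemma subinterval_mean (q l x u v : nat) (d A e : R) : (0 < q)%N -> (0 < l)%N ->
  0 <= A <= 1 -> 0 <= d -> 0 < e ->
  (forall c, (c < q)%N -> `|(P (x + c.+1 * l)%N - P (x + c * l)%N) / l%:R - A| <= d) ->
  (x <= u)%N -> (u <= v)%N -> (v <= x + q * l)%N -> e * (q * l)%:R <= (v - u)%:R ->
  `|(P v - P u) / (v - u)%:R - A| <= 2 * (d + q%:R^-1) / e.
Proof.
move=> q0 l0 A01 d0 e0 close xu uv vq long.
have ql0 : 0 < (q * l)%:R :> R by rewrite ltr0n muln_gt0 q0.
have w0 : 0 < (v - u)%:R :> R by apply: lt_le_trans long; rewrite mulr_gt0.
have vle : (v - x <= q * l)%N by rewrite leq_subLR.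
have ule : (u - x <= q * l)%N := leq_trans (leq_sub2r _ uv) vle.
have := prefix_drift l0 A01 d0 close vle; have := prefix_drift l0 A01 d0 close ule.
rewrite !subnKC ?(leq_trans xu)// => hu hv.
rewrite -(ler_pM2r w0) -{2}[(v - u)%:R]gtr0_norm// -normrM mulrBl divfK ?lt0r_neq0//.
have -> : (v - u)%:R = (v - x)%:R - (u - x)%:R :> R.
  by rewrite -natrB ?leq_sub2r// subnBA// subnK// (leq_trans xu).
apply: (@le_trans _ _ (2 * (d + q%:R^-1) / e * (e * (q * l)%:R))).
  rewrite (_ : 2 * _ / _ * _ = 2 * ((q * l)%:R * d + l%:R)); last first.
    by rewrite natrM; field; rewrite pnatr_eq0 -lt0n q0 lt0r_neq0.
  by move: hu hv; rewrite !ler_norml => /andP[? ?] /andP[? ?]; apply/andP; split; lra.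
rewrite -natrB ?leq_sub2r// subnBA// subnK ?(leq_trans xu)//.
by rewrite ler_wpM2l// divr_ge0 ?mulr_ge0 ?addr_ge0 ?(ltW e0).
Qed.

End prefix.

(** * Intervals of Z_n and level indicators *)

Lemma sum_interval_ord (V : zmodType) (n a b : nat) (F : nat -> V) :
  (a <= b <= n)%N ->
  \sum_(o in [set i : 'I_n | (a <= i < b)%N]%SET) F o = \sum_(i < b) F i - \sum_(i < a) F i.
Proof.
move=> /andP[ab bn].
rewrite (big_ord_widen_cond n predT F (leq_trans ab bn)) (big_ord_widen_cond n predT F bn).
rewrite [X in _ = X - _](bigID (fun i : 'I_n => (i < a)%N))/= addrAC.
rewrite [X in X - _](_ : _ = \sum_(i < n | (i < a)%N) F i) ?subrr ?add0r; last first.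
  apply: eq_bigl => i; case: (ltnP i a) => ia; rewrite ?andbF ?andbT//.
  by rewrite (leq_trans ia ab).
by apply: eq_bigl => i; rewrite inE -leqNgt andbC.
Qed.

Lemma card_interval_ord (n a b : nat) : (a <= b <= n)%N ->
  #|[set i : 'I_n | (a <= i < b)%N]%SET| = (b - a)%N.
Proof.
move=> abn; have /andP[ab _] := abn.
apply/eqP; rewrite -(eqr_nat int) natrB// -sum1_card natr_sum.
by rewrite (@sum_interval_ord _ n a b (fun=> 1%:R))// !sumr_const !card_ord.
Qed.

(** Extended by 0 beyond [n], so that prefix sums are defined on all of [nat]. *)
Definition level_indicator (R : realType) (n : nat) (sigma : {perm 'I_n}) (alpha : R)
    (i : nat) : R :=
  oapp (fun o : 'I_n => ((sigma o : nat)%:R < alpha * n%:R)%R%:R) 0 (insub i).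

Definition level_prefix (R : realType) (n : nat) (sigma : {perm 'I_n}) (alpha : R)
    (y : nat) : R :=
  \sum_(i < y) level_indicator sigma alpha i.

Lemma level_prefix_incr (R : realType) (n : nat) (sigma : {perm 'I_n}) (alpha : R) i :
  0 <= level_prefix sigma alpha i.+1 - level_prefix sigma alpha i <= 1.
Proof.
rewrite /level_prefix big_ord_recr/= addrAC subrr add0r.
rewrite /level_indicator.
by case: insubP => [y _ _|_] /=; rewrite ?lexx ?ler01// ler0n lern1 leq_b1.
Qed.

Lemma image_density_interval (R : realType) (n : nat) (sigma : {perm 'I_n})
    (alpha : R) (a b : nat) : (a <= b <= n)%N ->
  image_density sigma [set i : 'I_n | (a <= i < b)%N]%SET alpha =
  (level_prefix sigma alpha b - level_prefix sigma alpha a) / (b - a)%:R.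
Proof.
move=> abn; rewrite image_densityE card_interval_ord//; congr (_ / _).
rewrite /level_prefix -(sum_interval_ord (level_indicator sigma alpha) abn).
by apply: eq_bigr => o _; rewrite /level_indicator valK.
Qed.

(** * Partition into selected blocks *)

(** Taking the complement of the blocks in [G] as class 0 absorbs both the rejected blocks and the
    tail beyond [K * L]. *)
Lemma block_partition (n L K : nat) (G : {set 'I_K}) : (0 < L)%N -> (K * L <= n)%N ->
  exists C : 'I_#|G|.+1 -> {set 'I_n},
  [/\ interval_partition C,
      forall s, C (lift ord0 s) =
        [set o : 'I_n | (enum_val s * L <= o < (enum_val s).+1 * L)%N]%SET &
      #|C ord0| = (n - #|G| * L)%N].
Proof.
move=> L0 KL.
pose B (s : 'I_#|G|) := [set o : 'I_n | (enum_val s * L <= o < (enum_val s).+1 * L)%N]%SET.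
pose C (j : 'I_#|G|.+1) :=
  if unlift ord0 j is Some s then B s else (~: \bigcup_s B s)%SET.
have C0 : C ord0 = (~: \bigcup_s B s)%SET by rewrite /C unlift_none.
have CS s : C (lift ord0 s) = B s by rewrite /C liftK.
have Bn (i : 'I_K) : (i * L <= i.+1 * L <= n)%N.
  by rewrite leq_mul2r leqnSn orbT/= (leq_trans _ KL)// leq_mul2r ltn_ord orbT.
have cardB s : #|B s| = L by rewrite card_interval_ord// -mulnBl subSnn mul1n.
(* Membership becomes an equation on quotients, so disjointness reduces to injectivity of
   [enum_val]. *)
have BE s (o : 'I_n) : (o \in B s) = (o %/ L == enum_val s)%N.
  by rewrite inE -leq_divRL// -ltn_divLR// ltnS andbC -eqn_leq.
have disjB s t : s != t -> [disjoint B s & B t].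
  move=> st; apply/pred0P => o /=; rewrite !BE; apply/negP => /andP[/eqP-> /eqP].
  by move/ord_inj/enum_val_inj/eqP; apply/negP.
exists C; split => //; last first.
  rewrite C0 cardsCs finset.setCK card_ord -sum1_card partition_disjoint_bigcup//.
  by under eq_bigr do rewrite sum1_card cardB; rewrite sum_nat_const card_ord.
split.
- have CSC s : B s :&: C ord0 = finset.set0.
    rewrite C0; apply/setP => o; rewrite !inE; apply/negP => /andP[oB /negP]; apply.
    by apply/bigcupP; exists s => //; rewrite inE.
  move=> i j; case: (unliftP ord0 i) => [s|] ->; case: (unliftP ord0 j) => [t|] ->.
  + rewrite !CS => st; apply/disjoint_setI0/disjB.
    by apply: contraNneq st => ->.
  + by rewrite CS CSC.
  + by rewrite CS finset.setIC CSC.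
  + by rewrite eqxx.
- rewrite big_ord_recl; under eq_bigr do rewrite CS.
  by rewrite C0 finset.setUC finset.setUCr.
- move=> s; rewrite CS; split; first by rewrite -card_gt0 cardB.
  by exists (enum_val s * L)%N, ((enum_val s).+1 * L)%N.
Qed.

(** * Choice of the parameters and assembly *)

Theorem theorem2 (R : realType) (m : nat) (eps : R) (m_gt0 : (0 < m)%N)
    (eps_gt0 : 0 < eps) (eps_lt1 : eps < 1) :
  exists M N : nat,
    forall (n : nat), (N <= n)%N -> forall sigma : {perm 'I_n},
    exists k : nat, (m <= k <= M)%N /\
    exists (F : 'I_k -> R -> R) (C : 'I_k.+1 -> {set 'I_n}),
      (forall j : 'I_k, [/\ maps01 (F j), nondecreasing01 (F j) &
                           smooth01 (F j)]) /\
      uniform_partition eps sigma F C.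
Proof.
have ltS (x : R) : x < (Num.truncn x).+1%:R by exact: truncnS_gt.
(* [near_smooth_density] loses a factor 4. *)
pose e := eps / 4; have e0 : 0 < e by rewrite divr_gt0.
pose T := (Num.truncn e^-1).+1.
have eT : 1 <= e * T%:R by rewrite mulrC -ler_pdivrMr// mul1r ltW.
(* With [q^-1 <= d], the error [2 * (d + q^-1) / eps] of [subinterval_mean] is at most [e]. *)
pose d := eps * e / 4; have d0 : 0 < d by rewrite divr_gt0// mulr_gt0.
pose q := (Num.truncn d^-1).+1; have q0 : (0 < q)%N by [].
have qd : q%:R^-1 <= d by rewrite -[leRHS]invrK lef_pV2 ?posrE ?ltr0n ?invr_gt0// ltW.
(* Half of [eps] is allotted to the bad blocks, the other half to the remainder of the division. *)
pose gain := eps / 2 * d ^+ 2.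
have gain0 : 0 < gain by rewrite mulr_gt0 ?divr_gt0 ?exprn_gt0.
pose J := (Num.truncn (T.+2%:R * q%:R / gain)).+1.
have Jbig : T.+2%:R * q%:R < J%:R * gain by rewrite -ltr_pdivrMr.
(* More than half of the blocks will be good, so starting from [2 * m] leaves at least [m]. *)
pose k0 := (2 * m)%N; have k00 : (0 < k0)%N by rewrite muln_gt0.
pose K := (k0 * q ^ J)%N; have K0 : (0 < K)%N by rewrite muln_gt0 k00 expn_gt0.
exists K, (Num.truncn (2 * K%:R / eps)).+1 => n nN sigma.
have Kn : 2 * K%:R <= eps * n%:R.
  by rewrite [leRHS]mulrC -ler_pdivrMr// (le_trans (ltW (ltS _)))// ler_nat.
have Kn' : (K <= n)%N.
  rewrite -(ler_nat R); have : 0 <= n%:R :> R by [].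
  have : 0 <= K%:R :> R by [].
  nra.
pose b := (n %/ K)%N; have b0 : (0 < b)%N by rewrite divn_gt0.
pose P (t : 'I_T.+2) := level_prefix sigma (t%:R / T%:R : R).
(* Division with remainder occurs only once, at the finest scale; coarser blocks are exact unions of
   finest ones. *)
pose L j := (b * q ^ (J - j))%N.
have L0 j : (0 < L j)%N by rewrite muln_gt0 b0 expn_gt0.
have LS j : (j < J)%N -> L j = (q * L j.+1)%N.
  by move=> jJ; rewrite /L mulnCA -expnS subnSK.
pose a j i t := block_mean (P t) (L j) i.
have a01 j i t : 0 <= a j i t <= 1.
  by apply: block_mean01 => // x; exact: level_prefix_incr.
have a_mean j i t : (j < J)%N -> \sum_(c < q) a j.+1 (i * q + c)%N t = q%:R * a j i t.
  by move=> jJ; rewrite /a block_mean_sum// (LS j jJ).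
have [j jJ bad] := energy_pigeonhole q0 k00 d0 a01 a_mean Jbig.
pose k := (k0 * q ^ j)%N; rewrite -/k in bad.
pose G := [set i : 'I_k | good_block q a d j i]%SET.
have kL : (k * L j = b * K)%N.
  by rewrite /k /L /K mulnCA -mulnA -expnD subnKC ?(ltnW jJ).
have kLn : (k * L j <= n)%N by rewrite kL leq_trunc_div.
have GE : k%:R = #|G|%:R + #|[set i : 'I_k | ~~ good_block q a d j i]%SET|%:R :> R.
  rewrite -natrD -[in LHS](card_ord k) -(cardsC G); congr (_ + _)%:R.
  by apply: eq_card => i; rewrite !inE.
have Gbig : (1 - eps / 2) * k%:R <= #|G|%:R by move: bad GE; lra.
have [C [CP CS C0]] := block_partition G (L0 j) kLn.
have k2m : 2 * m%:R <= k%:R :> R.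
  by rewrite -natrM ler_nat leq_pmulr// expn_gt0.
exists #|G|; split.
  apply/andP; split.
    by rewrite -(ler_nat R); have : 0 <= k%:R :> R by []; nra.
  rewrite (leq_trans (max_card _))// card_ord leq_mul2l orbC leq_pexp2l//.
  exact: ltnW.
exists (fun s => smooth_density sigma (C (lift ord0 s)) e), C.
have C_neq0 s : C (lift ord0 s) != finset.set0 by have [_ _ /(_ s)[]] := CP.
have cardC s : #|C (lift ord0 s)| = L j.
  rewrite CS card_interval_ord -?mulnBl ?subSnn ?mul1n//.
  by rewrite leq_mul2r leqnSn orbT/= (leq_trans _ kLn)// leq_mul2r ltn_ord orbT.
split.
  move=> s; split; first exact: smooth_density01.
  - by move=> x y _ xy _; exact: smooth_density_le.
  - exact: smooth01_logistic_sum.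
split => //.
- by move=> s t; rewrite !cardC.
(* The bad blocks cover at most [eps / 2 * n] points, and the remainder has fewer than [K] points,
   hence at most [eps / 2 * n] by [Kn]. *)
- rewrite C0 natrB; last first.
    by apply: leq_trans kLn; rewrite leq_mul2r (leq_trans (max_card _)) ?orbT// card_ord.
  have nb : n%:R < b%:R * K%:R + K%:R :> R.
    by rewrite -natrM -natrD ltr_nat -mulSnr ltn_ceil.
  have GL : (1 - eps / 2) * (b%:R * K%:R) <= #|G|%:R * (L j)%:R.
    by rewrite -natrM -kL natrM mulrA ler_wpM2r.
  rewrite natrM.
  have : b%:R * K%:R <= n%:R :> R by rewrite -natrM ler_nat -kL.
  nra.
- move=> s I [u [v IE]] sub long.
  have I0 : (0 < #|I|)%N.
    by rewrite -(ltr_nat R); apply: lt_le_trans long; rewrite cardC mulr_gt0// ltr0n.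
  have [y yI] : exists y, y \in I by apply/set0Pn; rewrite -card_gt0.
  have /andP[uy yv] : (u <= y < v)%N by move: yI; rewrite IE inE.
  (* The right end [v] may exceed [n]. Once it is capped, [u] and [v'.-1] are points of [I], which
     forces both ends to lie within the block. *)
  pose v' := minn v n.
  have un : (u < n)%N := leq_ltn_trans uy (ltn_ord y).
  have uv : (u < v')%N by rewrite leq_min un (leq_ltn_trans uy).
  have v'n : (v' <= n)%N by exact: geq_minr.
  have IE' : I = [set i : 'I_n | (u <= i < v')%N]%SET.
    by apply/setP => i; rewrite IE !inE leq_min ltn_ord andbT.
  set x := (enum_val s * L j)%N; pose l := L j.+1; have Lql : L j = (q * l)%N := LS j jJ.
  have xu : (x <= u)%N.
    have : Ordinal un \in C (lift ord0 s).
      by apply: (fintype.subsetP sub); rewrite IE' inE /= leqnn.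
    by rewrite CS inE => /andP[].
  have vx : (v' <= x + q * l)%N.
    have v1n : (v'.-1 < n)%N by rewrite prednK// (leq_trans _ uv).
    have : Ordinal v1n \in C (lift ord0 s).
      by apply: (fintype.subsetP sub); rewrite IE' inE /=; move: uv; clear; lia.
    by rewrite CS inE -Lql /x -mulSnr => /andP[_] /=; rewrite prednK ?(leq_trans _ uv).
  have -> : eps = 4 * e by rewrite /e; field.
  apply: (@near_smooth_density _ _ _ _ _ e0 (C_neq0 s) _ T eT) => t.
  rewrite IE' CS !image_density_interval; last 2 first.
  - by rewrite leq_mul2r leqnSn orbT/= (leq_trans _ kLn)// leq_mul2r ltn_ord orbT.
  - by rewrite v'n ltnW.
  rewrite -mulnBl subSnn mul1n -/(P t).
  have l0 : (0 < l)%N by exact: L0.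
  have long' : eps * (q * l)%:R <= (v' - u)%:R.
    by move: long; rewrite cardC Lql IE' card_interval_ord// v'n ltnW.
  have close c : (c < q)%N ->
      `|(P t (x + c.+1 * l)%N - P t (x + c * l)%N) / l%:R - a j (enum_val s) t| <= d.
    move=> cq; have := enum_valP s; rewrite inE => /forallP/(_ t)/forallP/(_ (Ordinal cq)).
    by rewrite /= {1}/a /block_mean -addnS !mulnDl -mulnA -/l -Lql.
  have := subinterval_mean (fun i => level_prefix_incr sigma _ i) q0 l0 (a01 j (enum_val s) t)
    (ltW d0) eps_gt0 close xu (ltnW uv) vx long'.
  move=> /le_trans; apply; rewrite ler_pdivrMr//.
  by move: qd; rewrite /d /e; lra.
Qed.
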